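(* Let $x^* \in \Omega$ be a locally optimal solution of the problem $(\mathcal{P})$, let $f$ be Lipschitz continuous near $x^*$ with Lipschitz constant $L$, and let $G$ be metrically subregular with respect to the set $A$ at $(x^*, 0)$ with constant $\tau > 0$. Suppose also that there exist $t_0, \phi_0, \omega_0 > 0$ such that $$\phi(t) \ge \phi_0 t, \quad \omega(t) \ge \omega_0 t \quad \forall t \in [0, t_0].$$ Then the singular penalty function $F_{\lambda}$ is exact at $x^*$, and $$\lambda^*(x^* ) \le \frac{L \big(\sqrt{\phi_0}\, \| w \| + \sqrt{\omega_0 + \phi_0 \| w \|^2}\big)}{2 \omega_0 \sqrt{\phi_0}\, \tau}.$$
   Context: Setting. $X$ is a metric space, $Y$ a normed space, $A \subset X$ nonempty, $f \colon X \to \mathbb{R} \cup \{+\infty\}$, and $G \colon X \rightrightarrows Y$ a set-valued mapping with closed values. The problem $(\mathcal{P})$ is: minimize $f(x)$ subject to $0 \in G(x)$, $x \in A$; its feasible set is $\Omega = G^{-1}(0) \cap A = \{x \in A : 0 \in G(x)\}$. Singular penalty function. Fix $w \in Y$ and non-decreasing functions $\phi \colon [0, +\infty] \to [0, +\infty]$, $\omega \colon [0,+\infty) \to [0, +\infty]$ such that $\phi(t) = 0$ iff $t = 0$ and $\omega(t) = 0$ iff $t = 0$. For $(x,p) \in X \times [0,+\infty)$ put $\varphi(x,p) = 0$ if $x \in \Omega$, $p = 0$; $\varphi(x,p) = +\infty$ if $x \notin \Omega$, $p = 0$; and $\varphi(x,p) = p^{-1} \phi( d(0, G(x) - p w)^2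 ) + \omega(p)$ if $p > 0$, where $d(0, G(x) - pw) = \inf_{y \in G(x)} \|y - pw\|$ if $G(x) \neq \emptyset$, and $= +\infty$ if $G(x) = \emptyset$. The singular penalty function is $F_\lambda(x,p) = f(x) + \lambda \varphi(x,p)$, $\lambda \ge 0$. Exactness at $x^*$: there exists $\lambda_0 \ge 0$ such that $(x^*, 0)$ is a local minimizer of $F_{\lambda_0}$ on $A \times [0,+\infty)$; $\lambda^*(x^* )$ denotes the infimum of all such $\lambda_0$. Metric subregularity of $G$ with respect to $A$ at $(x^*,0)$ with constant $\tau > 0$: there exists a neighbourhood $U$ of $x^*$ such that $d(0, G(x)) \ge \tau\, d(x, G^{-1}(0) \cap A)$ for all $x \in U \cap A$. *)

(* Defs.v *)
From HB Require Import structures.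
From mathcomp Require Import all_boot all_order all_algebra.
From mathcomp Require Import all_classical all_reals all_analysis.

Set Implicit Arguments.
Unset Strict Implicit.
Unset Printing Implicit Defensive.

Import Order.TTheory GRing.Theory Num.Theory.
Import numFieldNormedType.Exports.

Local Open Scope classical_set_scope.
Local Open Scope ring_scope.

(* The infimum of the empty set is +oo, so both distances to set0 are +oo. *)
Definition metric_dist (R : realType) (X : metricType R) (x : X) (S : set X)
    : \bar R :=
  ereal_inf [set (mdist x z)%:E | z in S].

Definition norm_dist (R : realType) (Y : normedModType R) (y : Y) (S : set Y)
    : \bar R :=
  ereal_inf [set `|z - y|%:E | z in S].

Definition local_minimizer (R : realType) (T : topologicalType)
    (h : T -> \bar R) (S : set T) (t : T) : Prop :=
  S t /\ \forall u \near t, S u -> (h t <= h u)%E.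

Definition lipschitz_near (R : realType) (X : metricType R)
    (f : X -> \bar R) (x : X) (L : R) : Prop :=
  0 <= L /\
  exists2 U : set X, nbhs x U &
    (forall y, U y -> f y \is a fin_num) /\
    (forall y z, U y -> U z -> `|fine (f y) - fine (f z)| <= L * mdist y z).

Section problem.
Context (R : realType) (X : metricType R) (Y : normedModType R).
Context (f : X -> \bar R) (G : X -> set Y) (A : set X).

Definition feasible_set : set X := [set x | G x 0] `&` A.

Definition locally_optimal (xs : X) : Prop :=
  local_minimizer f feasible_set xs.

Definition metrically_subregular (xs : X) (tau : R) : Prop :=
  \forall x \near xs, A x ->
    (tau%:E * metric_dist x feasible_set <= norm_dist 0%R (G x))%E.

Context (w : Y) (phi : \bar R -> \bar R) (omega : R -> \bar R).

(* Only meaningful for 0 <= p. *)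
Definition penalty_term (x : X) (p : R) : \bar R :=
  if p == 0 then (if x \in feasible_set then 0%E else +oo%E)
  else (p^-1%:E * phi (norm_dist 0%R [set (y - p *: w)%R | y in G x] ^+ 2)
        + omega p)%E.

(* At lambda = 0 the \bar R convention 0 * +oo = 0 makes F_0(x, p) = f x; this
   affects neither exactness nor the value of lambda_star. *)
Definition penalty_function (lambda : R) (xp : X * R) : \bar R :=
  (f xp.1 + lambda%:E * penalty_term xp.1 xp.2)%E.

Definition exact_parameter (xs : X) : set R :=
  [set lambda | 0 <= lambda /\
     local_minimizer (penalty_function lambda) (A `*` [set p | 0 <= p])
       (xs, 0)].

Definition exact_at (xs : X) : Prop := exists lambda, exact_parameter xs lambda.

Definition lambda_star (xs : X) : \bar R :=
  ereal_inf [set lambda%:E | lambda in exact_parameter xs].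

End problem.

(* Main.v *)
Require Import Defs.
From HB Require Import structures.
From mathcomp Require Import all_boot all_order all_algebra.
From mathcomp Require Import all_classical all_reals all_analysis.
From mathcomp Require Import ring lra.

Set Implicit Arguments.
Unset Strict Implicit.
Unset Printing Implicit Defensive.

Import Order.TTheory GRing.Theory Num.Theory.
Import numFieldNormedType.Exports.

Local Open Scope classical_set_scope.
Local Open Scope ring_scope.

(* Since [f] is Lipschitz near [xs], locally [f xs <= f x + L d(x, Omega)], so it
   suffices that [lambda * penalty_term x p >= L d(x, Omega)] near [(xs, 0)].
   Subregularity gives [d(0, G x - p w) >= s] and [tau d(x, Omega) <= s + p |w|]
   for [s = max(0, tau d(x, Omega) - p |w|)], which is small, so the linear lower
   bounds on [phi] and [omega] apply by monotonicity of [phi]. What remains is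
   [lambda tau (phi0 s^2 / p + omega0 p) >= L (s + p |w|)], a quadratic
   inequality in [s / p], for which the [lambda] of the theorem is the exact
   threshold. *)

Lemma metric_dist_le (R : realType) (X : metricType R) (S : set X) (x z : X) :
  S z -> (metric_dist x S <= (mdist x z)%:E)%E.
Proof. by move=> Sz; apply: ereal_inf_lbound; exists z. Qed.

Lemma metric_dist_ge0 (R : realType) (X : metricType R) (S : set X) (x : X) :
  (0 <= metric_dist x S)%E.
Proof. by apply: le_ereal_inf_tmp => _ [z _ <-]; rewrite lee_fin mdist_ge0. Qed.

Lemma metric_dist_fin_num (R : realType) (X : metricType R) (S : set X)
    (x z : X) :
  S z -> metric_dist x S \is a fin_num.
Proof.
move=> Sz; rewrite ge0_fin_numE ?metric_dist_ge0//.
by rewrite (le_lt_trans (metric_dist_le x Sz))// ltry.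
Qed.

Lemma norm_dist_ge0 (R : realType) (Y : normedModType R) (S : set Y) (y : Y) :
  (0 <= norm_dist y S)%E.
Proof. by apply: le_ereal_inf_tmp => _ [z _ <-]; rewrite lee_fin. Qed.

Lemma norm_dist_shift (R : realType) (Y : normedModType R) (S : set Y) (v : Y)
    (r : R) :
  (r%:E <= norm_dist 0%R S)%E ->
  ((r - `|v|)%:E <= norm_dist 0%R [set (y - v)%R | y in S])%E.
Proof.
move=> rS; apply: le_ereal_inf_tmp => _ [_ [y Sy <-] <-].
have : (norm_dist 0%R S <= `|y|%:E)%E.
  by apply: ereal_inf_lbound; exists y; rewrite ?subr0.
move=> /(le_trans rS); rewrite !lee_fin subr0 => ry.
by rewrite (le_trans _ (lerB_dist _ _))// lerB.
Qed.

(* A point of [S] far from [x] satisfies the bound because [xs] is closer. *)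
Lemma local_minimizer_dist (R : realType) (X : metricType R) (f : X -> \bar R)
    (S : set X) (xs : X) (L : R) :
  local_minimizer f S xs -> lipschitz_near f xs L ->
  \forall x \near xs, (f xs <= f x + L%:E * metric_dist x S)%E.
Proof.
move=> [Sxs minf] [L0 [U nU [finU lipU]]].
have [r /= r0 rP] := (nbhs_ballP xs _).1 (filterI nU minf).
(* Half the radius keeps every [z] within [r / 2] of [x] inside the ball of radius [r] around [xs],
   where both the Lipschitz bound and the minimality of [xs] are available. *)
apply/nbhs_ballP; exists (r / 2); first by rewrite /= divr_gt0.
move=> x; rewrite ballEmdist /= => xr.
have Uxs : U xs by apply: (rP xs _).1; exact: ballxx.
have Ux : U x.
  by apply: (rP x _).1; rewrite ballEmdist/=; apply: (lt_trans xr); lra.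
have fxs := finU _ Uxs; have fx := finU _ Ux.
have symx : mdist x xs = mdist xs x by exact: metric_sym.
have key : fine (f xs) - fine (f x) <= L * mdist xs x.
  by rewrite (le_trans (ler_norm _))// lipU.
have -> : metric_dist x S = (fine (metric_dist x S))%:E.
  by rewrite fineK//; exact: metric_dist_fin_num Sxs.
rewrite -(fineK fxs) -(fineK fx) -EFinM -EFinD lee_fin -lerBlDl.
(* For [L > 0], dividing by [L] isolates the infimum, so that the bound can be checked at each [z]
   of [S] separately; [L = 0] has to be settled first. *)
move: L0; rewrite le_eqVlt => /predU1P[L0|L0].
  by move: key; rewrite -L0 !mul0r.
rewrite mulrC -ler_pdivrMr// -lee_fin fineK; last exact: metric_dist_fin_num Sxs.
apply: le_ereal_inf_tmp => _ [z Sz <-].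
rewrite lee_fin ler_pdivrMr// mulrC.
have [zr|zr] := ltP (mdist x z) (r / 2); last first.
  by rewrite (le_trans key)// ler_wpM2l ?(ltW L0)// (le_trans _ zr)// ltW.
have bz : ball xs r z.
  rewrite ballEmdist /= (le_lt_trans (metric_triangle _ x _))//.
  by rewrite (splitr r) ltrD.
have [Uz minz] := rP z bz.
have := minz Sz; rewrite -(fineK fxs) -(fineK (finU _ Uz)) lee_fin => fz.
have := le_trans (ler_norm _) (lipU z x Uz Ux).
rewrite (metric_sym z x) => fzx.
by rewrite (le_trans _ fzx)// lerB.
Qed.

(** The bound of the theorem, with [W] for the norm of [w]. It is proportional to [L / tau], so its
    value at [L = tau = 1] carries the whole quadratic argument. *)
Definition penalty_threshold {R : realType} (L phi0 omega0 tau W : R) : R :=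
  L * (Num.sqrt phi0 * W + Num.sqrt (omega0 + phi0 * W ^+ 2))
    / (2 * omega0 * Num.sqrt phi0 * tau).

(* [K] is the positive root of [4 phi0 omega0 K^2 - 4 phi0 W K - 1], which makes
   [K (phi0 s^2 + omega0 p^2) - p s - p^2 W] a perfect square up to a factor. *)
Lemma quadratic_threshold (R : realType) (phi0 omega0 W s p : R) :
  0 < phi0 -> 0 < omega0 -> 0 <= W ->
  p * (s + p * W) <=
    penalty_threshold 1 phi0 omega0 1 W * (phi0 * s ^+ 2 + omega0 * p ^+ 2).
Proof.
move=> phi0_gt0 omega0_gt0 W0; set K := penalty_threshold _ _ _ _ _.
pose a := Num.sqrt phi0; pose b := Num.sqrt (omega0 + phi0 * W ^+ 2).
have a0 : 0 < a by rewrite sqrtr_gt0.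
have aE : a ^+ 2 = phi0 by rewrite sqr_sqrtr// ltW.
have rad0 : 0 < omega0 + phi0 * W ^+ 2.
  by rewrite ltr_pwDl// mulr_ge0// ?sqr_ge0// ltW.
have b0 : 0 < b by rewrite sqrtr_gt0.
have bE : b ^+ 2 = omega0 + phi0 * W ^+ 2 by rewrite sqr_sqrtr// ltW.
have KE : K = (a * W + b) / (2 * omega0 * a).
  by rewrite /K /penalty_threshold mul1r mulr1.
clearbody K.
have K0 : 0 < K.
  by rewrite KE divr_gt0 ?mulr_gt0// ltr_wpDl// mulr_ge0// ltW.
have Kroot : 4 * phi0 * omega0 * K ^+ 2 = 4 * phi0 * W * K + 1.
  have K2 : 2 * omega0 * a * K = a * W + b.
    by rewrite KE mulrC divfK// !mulf_neq0 ?gt_eqF.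
  (* The factor [omega0] turns the equation into one in [2 * omega0 * a * K]; completing the square
     reduces it to [b ^+ 2 - (a * W) ^+ 2 = omega0]. *)
  have : omega0 * (4 * phi0 * omega0 * K ^+ 2 - (4 * phi0 * W * K + 1)) = 0.
    have -> : omega0 * (4 * phi0 * omega0 * K ^+ 2 - (4 * phi0 * W * K + 1)) =
        (2 * omega0 * a * K) ^+ 2 - 2 * a * W * (2 * omega0 * a * K) - omega0.
      by rewrite -aE; ring.
    by rewrite K2 -[X in _ - X](addrK (phi0 * W ^+ 2)) -bE -aE; ring.
  by move=> /eqP; rewrite mulf_eq0 gt_eqF//= subr_eq0 => /eqP.
have Kphi0 : 0 < 4 * K * phi0 by rewrite !mulr_gt0.
rewrite -subr_ge0 -(pmulr_rge0 _ Kphi0).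
have -> : 4 * K * phi0 * (K * (phi0 * s ^+ 2 + omega0 * p ^+ 2) - p * (s + p * W))
    = (4 * phi0 * omega0 * K ^+ 2) * p ^+ 2 - 4 * phi0 * W * K * p ^+ 2
      + 4 * phi0 ^+ 2 * K ^+ 2 * s ^+ 2 - 4 * K * phi0 * p * s by ring.
rewrite Kroot.
have -> : (4 * phi0 * W * K + 1) * p ^+ 2 - 4 * phi0 * W * K * p ^+ 2
      + 4 * phi0 ^+ 2 * K ^+ 2 * s ^+ 2 - 4 * K * phi0 * p * s
    = (2 * K * phi0 * s - p) ^+ 2 by ring.
exact: sqr_ge0.
Qed.

(** The factor [L / tau] of the threshold cancels against the bound on [tau * d], and multiplying by
    [p] leaves the quadratic inequality in [s] and [p]. *)
Lemma penalty_threshold_dominates (R : realType)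
    (L phi0 omega0 tau W d s p : R) :
  0 <= L -> 0 < phi0 -> 0 < omega0 -> 0 < tau -> 0 <= W -> 0 < p ->
  tau * d <= s + p * W ->
  L * d <= penalty_threshold L phi0 omega0 tau W *
    (p^-1 * (phi0 * s ^+ 2) + omega0 * p).
Proof.
move=> L0 phi0_gt0 omega0_gt0 tau0 W0 p0 ds.
have -> : penalty_threshold L phi0 omega0 tau W =
    L * (tau^-1 * penalty_threshold 1 phi0 omega0 1 W).
  by rewrite /penalty_threshold mulr1 mul1r !invfM; ring.
rewrite -mulrA ler_wpM2l// -mulrA ler_pdivlMl// (le_trans ds)//.
rewrite -(ler_pM2l p0) mulrCA.
have -> : p * (p^-1 * (phi0 * s ^+ 2) + omega0 * p) =
    phi0 * s ^+ 2 + omega0 * p ^+ 2 by field; rewrite gt_eqF.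
exact: quadratic_threshold.
Qed.

(** The linear bound on [phi] is used only at [s ^+ 2], which is at most [t0]; monotonicity then
    carries it to the squared distance, which may exceed [t0] or be infinite. *)
Lemma penalty_term_lb (R : realType) (X : metricType R) (Y : normedModType R)
    (G : X -> set Y) (A : set X) (w : Y) (phi : \bar R -> \bar R)
    (omega : R -> \bar R) (t0 phi0 omega0 : R) (x : X) (p s : R) :
  (forall s t, (0 <= s)%E -> (s <= t)%E -> (phi s <= phi t)%E) ->
  (forall t : R, 0 <= t <= t0 -> ((phi0 * t)%:E <= phi t%:E)%E) ->
  (forall t : R, 0 <= t <= t0 -> ((omega0 * t)%:E <= omega t)%E) ->
  0 < p -> p <= t0 -> 0 <= s -> s ^+ 2 <= t0 ->
  (s%:E <= norm_dist 0%R [set (y - p *: w)%R | y in G x])%E ->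
  ((p^-1 * (phi0 * s ^+ 2) + omega0 * p)%:E
    <= penalty_term G A w phi omega x p)%E.
Proof.
move=> phi_nondec phi_lb omega_lb p0 pt0 s0 st0 sD.
rewrite /penalty_term gt_eqF// EFinD EFinM; apply: leeD; last first.
  by rewrite omega_lb// ltW.
rewrite lee_wpmul2l ?lee_fin ?invr_ge0 ?(ltW p0)//.
apply: (le_trans (phi_lb _ _)); first by rewrite sqr_ge0.
apply: phi_nondec; first by rewrite lee_fin sqr_ge0.
by rewrite EFin_expe lee_sqr ?norm_dist_ge0// lee_fin.
Qed.

Theorem theorem4p1 (R : realType) (X : metricType R) (Y : normedModType R)
    (f : X -> \bar R) (G : X -> set Y) (A : set X)
    (w : Y) (phi : \bar R -> \bar R) (omega : R -> \bar R)
    (xs : X) (L tau t0 phi0 omega0 : R)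
    (A_neq0 : A !=set0)
    (f_neqNy : forall x, f x != -oo%E)
    (G_closed : forall x, closed (G x))
    (phi_ge0 : forall t, (0 <= t)%E -> (0 <= phi t)%E)
    (phi_nondec : forall s t, (0 <= s)%E -> (s <= t)%E -> (phi s <= phi t)%E)
    (phi_eq0 : forall t, (0 <= t)%E -> (phi t = 0%E <-> t = 0%E))
    (omega_ge0 : forall t, 0 <= t -> (0 <= omega t)%E)
    (omega_nondec : forall s t, 0 <= s -> s <= t -> (omega s <= omega t)%E)
    (omega_eq0 : forall t, 0 <= t -> (omega t = 0%E <-> t = 0))
    (xs_opt : locally_optimal f G A xs)
    (f_lip : lipschitz_near f xs L)
    (tau_gt0 : 0 < tau)
    (G_subreg : metrically_subregular G A xs tau)
    (t0_gt0 : 0 < t0) (phi0_gt0 : 0 < phi0) (omega0_gt0 : 0 < omega0)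
    (phi_lb : forall t : R, 0 <= t <= t0 -> ((phi0 * t)%:E <= phi t%:E)%E)
    (omega_lb : forall t : R, 0 <= t <= t0 -> ((omega0 * t)%:E <= omega t)%E) :
  exact_at f G A w phi omega xs /\
  (lambda_star f G A w phi omega xs <=
    (L * (Num.sqrt phi0 * `|w| + Num.sqrt (omega0 + phi0 * `|w| ^+ 2))
      / (2 * omega0 * Num.sqrt phi0 * tau))%:E)%E.
Proof.
have [Sxs _] := xs_opt; have [L0 _] := f_lip.
pose S := feasible_set G A.
pose lam := penalty_threshold L phi0 omega0 tau `|w|.
have num0 : 0 < Num.sqrt phi0 * `|w| + Num.sqrt (omega0 + phi0 * `|w| ^+ 2).
  rewrite ltr_wpDl ?mulr_ge0 ?sqrtr_ge0// sqrtr_gt0 ltr_pwDl//.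
  by rewrite mulr_ge0 ?sqr_ge0 ?ltW.
have den0 : 0 < 2 * omega0 * Num.sqrt phi0 * tau.
  by rewrite !mulr_gt0 ?sqrtr_gt0//.
have lam0 : 0 <= lam by rewrite /lam /penalty_threshold divr_ge0// ?mulr_ge0// ltW.
have lamE0 : 0 < L -> 0 < lam.
  by move=> ?; rewrite /lam /penalty_threshold divr_gt0// mulr_gt0.
suff lamP : exact_parameter f G A w phi omega xs lam.
  by split; [exists lam | apply: ereal_inf_lbound; exists lam].
split=> //; split; first by split; [exact: Sxs.2 | rewrite /= lexx].
have F0 : penalty_function f G A w phi omega lam (xs, 0) = f xs.
  by rewrite /penalty_function /penalty_term /= eqxx mem_set// mule0 adde0.
rewrite F0.
(* Since [xs] is feasible, this radius forces [tau * d <= Num.sqrt t0] for the distance [d] from [x]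
   to the feasible set, hence [s ^+ 2 <= t0] below. *)
have near_x : \forall x \near xs, mdist xs x < Num.sqrt t0 / tau.
  apply/nbhs_ballP; exists (Num.sqrt t0 / tau).
    by rewrite /= divr_gt0 ?sqrtr_gt0.
  by move=> x; rewrite ballEmdist.
have near_p : \forall p \near (0 : R), p <= t0.
  by apply: filterS (lt_nbhsl t0_gt0) => p /ltW.
have near_f := local_minimizer_dist xs_opt f_lip.
have near_xp : \forall xp \near (xs, 0 : R),
    [/\ (f xs <= f xp.1 + L%:E * metric_dist xp.1 S)%E,
      A xp.1 -> (tau%:E * metric_dist xp.1 S <= norm_dist 0%R (G xp.1))%E,
      mdist xs xp.1 < Num.sqrt t0 / tau & xp.2 <= t0].
  near=> xp; split; near: xp.
  - exact: (cvg_fst near_f).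
  - exact: (cvg_fst G_subreg).
  - exact: (cvg_fst near_x).
  - exact: (cvg_snd near_p).
apply: filterS near_xp => -[x p] /= [fx subreg xr pt0] [Ax p0].
apply: (le_trans fx); rewrite /penalty_function /=; apply: leeD2l.
have dfin := metric_dist_fin_num x Sxs.
rewrite -/S in dfin; set d := fine (metric_dist x S).
have dE : metric_dist x S = d%:E by rewrite fineK.
have dle : d <= mdist xs x.
  by rewrite -lee_fin -dE metric_sym; exact: metric_dist_le.
rewrite dE -EFinM; move: p0; rewrite /= le_eqVlt => /predU1P[p0|p0].
  rewrite -p0 /penalty_term eqxx; case: ifPn => [|_].
    rewrite inE => Sx; rewrite mule0 lee_fin.
    have : d <= 0 by rewrite -lee_fin -dE -(mdistxx x); exact: metric_dist_le.
    exact: mulr_ge0_le0.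
  (* At an infeasible [x] with [p = 0] the penalty is infinite. If [L > 0] then [lam > 0] and the
     product stays infinite; if [L = 0] the left side vanishes and nonnegativity suffices, whatever
     [0 * +oo] is. *)
  move: L0; rewrite le_eqVlt => /predU1P[<-|/lamE0 L0].
    by rewrite mul0r mule_ge0// lee_fin.
  by rewrite gt0_muley ?leey// lte_fin.
(* Subregularity and the shift by [p *: w] bound the distance below by [tau * d - p * |w|].
   Truncating at 0 keeps the bound valid and allows squaring it. *)
pose s := Num.max 0 (tau * d - p * `|w|).
have s0 : 0 <= s by rewrite le_max lexx.
have ds : tau * d <= s + p * `|w| by rewrite -lerBlDr le_max lexx orbT.
have st0 : s ^+ 2 <= t0.
  rewrite -(sqr_sqrtr (ltW t0_gt0)) ler_sqr ?nnegrE ?sqrtr_ge0//.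
  rewrite ge_max sqrtr_ge0 /= (@le_trans _ _ (tau * d))//.
    by rewrite lerBlDr lerDl mulr_ge0// ltW.
  by rewrite mulrC -ler_pdivlMr// (le_trans dle)// ltW.
have sD : (s%:E <= norm_dist 0%R [set (y - p *: w)%R | y in G x])%E.
  rewrite EFin_max ge_max norm_dist_ge0 /=.
  have -> : p * `|w| = `|p *: w| by rewrite normrZ gtr0_norm.
  by apply: norm_dist_shift; rewrite EFinM -dE; exact: subreg.
have pen := penalty_term_lb A phi_nondec phi_lb omega_lb p0 pt0 s0 st0 sD.
apply: (@le_trans _ _
  (lam * (p^-1 * (phi0 * s ^+ 2) + omega0 * p))%:E); last first.
  by rewrite EFinM lee_wpmul2l ?lee_fin.
by rewrite lee_fin penalty_threshold_dominates.
Unshelve. all: by end_near.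
Qed.
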